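(* Fix a prime power $q$ and an integer $m\geq 1$. Along any joint limit with $n\to\infty$ and $\ell\to\infty$, the attenuated-space association scheme on $\Omega_m=\Omega_m(q,n,\ell)$ satisfies $$\operatorname{cdim}(\Omega_m)\;\geq\;\left(\frac{m(q-1)}{(q^m-1)^2}+o(1)\right)q^{n+\ell}.$$ Moreover (using the known incidence-rank upper bound of Guo, Li and Wang for $m\ge2$, and the exact formula $\operatorname{cdim}(\Omega_1)=(q^\ell-1)\frac{q^n-1}{q-1}$ for $m=1$), $$\operatorname{cdim}(\Omega_m)=\Theta_{q,m}(q^{n+\ell}).$$
   Context: Attenuated-space scheme: let $V$ be an $(n+\ell)$-dimensional vector space over $\mathbb F_q$ and $E\leq V$ a fixed $\ell$-dimensional subspace. For $1\leq m\leq n$ let $$\Omega_m=\{X\leq V:\dim X=m,\ X\cap E=0\}.$$ Let $W$ be a complement to $E$ in $V$ and $\pi:V\to W$ the projection along $E$; for $X\in\Omega_m$, $\pi(X)$ is an $m$-dimensional subspace of $W$. The set $\Omega_m$ carries a symmetric association scheme whose relations are indexed by pairs $(i,j)$: $(X,Y)\in R_{(i,j)}$ if and only if $\dim(\pi(X)\cap\pi(Y))=m-i$ and $\dim(X\cap Y)=m-i-j$. A pair $(i,j)$ is regarded as a single relation label. Class dimension: for a symmetric association scheme on a finite set $\Omega$ and $s,x\in\Omega$, let $i(s,x)$ be the label of the unique relation containing $(s,x)$. A set $S\subseteq\Omega$ is class-resolving if $x\mapsto(i(s,x))_{s\in S}$ is injective on $\Omega$; $\operatorname{cdim}(\Omega)$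 is the least size of a class-resolving set. Known upper bound from the literature (Guo, Li, Wang): for $2\leq m\leq n-1$, $\operatorname{cdim}(\Omega_m)\leq q^\ell\,\frac{q^n-1}{q-1}$. Here $q,m$ are fixed, $o(1)\to 0$ as $n,\ell\to\infty$ jointly, and $\Theta_{q,m}$ means bounded above and below by positive constant multiples (constants depending only on $q,m$) for all sufficiently large $n$ and $\ell$. *)

(* Defs.v *)
From HB Require Import structures.
From mathcomp Require Import all_boot all_order all_algebra.

Set Implicit Arguments.
Unset Strict Implicit.
Unset Printing Implicit Defensive.

Import Order.TTheory GRing.Theory Num.Theory.

Import VectorInternalTheory.

Local Open Scope nat_scope.

HB.instance Definition _ (F : finFieldType) (V : vectType F) :=
  [Countable of {vspace V} by <:].
HB.instance Definition _ (F : finFieldType) (V : vectType F) :=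
  [Finite of {vspace V} by <:].

(* A finite set [Omega] whose pairs are partitioned by relations [R l], as in a
   symmetric association scheme; the class dimension uses only the partition. *)

Definition rel_label (T L : finType) (R : L -> rel T) (s x : T) : option L :=
  [pick l | R l s x].

Definition class_resolving (T L : finType) (Omega : {set T}) (R : L -> rel T)
    (S : {set T}) : bool :=
  (S \subset Omega) &&
  [forall x in Omega, forall y in Omega,
     [forall s in S, rel_label R s x == rel_label R s y] ==> (x == y)].

(* [Omega] itself is class-resolving as soon as the diagonal is a class, so it
   is a legitimate default for the minimum. *)
Definition cdim (T L : finType) (Omega : {set T}) (R : L -> rel T) : nat :=
  #|[arg min_(S < Omega | class_resolving Omega R S) #|S| ]|.

Lemma class_resolvingP (T L : finType) (Omega : {set T}) (R : L -> rel T)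
    (S : {set T}) :
  reflect (S \subset Omega /\
           {in Omega &, forall x y,
              {in S, forall s, rel_label R s x = rel_label R s y} -> x = y})
          (class_resolving Omega R S).
Proof.
apply: (iffP andP) => -[sSO H]; split=> //.
  move=> x y xO yO xy; apply/eqP.
  move/forall_inP/(_ x xO)/forall_inP/(_ y yO)/implyP: H; apply.
  by apply/forall_inP=> s sS; apply/eqP/xy.
apply/forall_inP=> x xO; apply/forall_inP=> y yO; apply/implyP=> xy.
by apply/eqP/H=> // s sS; apply/eqP/(forall_inP xy).
Qed.

Lemma cdimP (T L : finType) (Omega : {set T}) (R : L -> rel T) :
  class_resolving Omega R Omega ->
  (exists2 S, class_resolving Omega R S & #|S| = cdim Omega R) /\
  (forall S, class_resolving Omega R S -> cdim Omega R <= #|S|).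
Proof. by rewrite /cdim => H; case: arg_minnP => // S HS Smin; split; [exists S|]. Qed.

Definition att_frame (F : finFieldType) (V : vectType F) (n l : nat)
    (E W : {vspace V}) : Prop :=
  [/\ \dim {:V} = n + l, \dim E = l, (E :&: W = 0)%VS & (E + W = fullv)%VS].

Definition att_points (F : finFieldType) (V : vectType F) (E : {vspace V})
    (m : nat) : {set {vspace V}} :=
  [set X : {vspace V} | (\dim X == m) && (X :&: E == 0)%VS].

Definition att_proj (F : finFieldType) (V : vectType F) (E W X : {vspace V}) :
    {vspace V} :=
  (daddv_pi W E @: X)%VS.

(* dim (pi X :&: pi Y) = m - i and dim (X :&: Y) = m - i - j, written without
   the truncated subtraction of nat, under which labels with i + j > m would
   also be attained. *)
Definition att_rel (F : finFieldType) (V : vectType F) (E W : {vspace V})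
    (m : nat) (ij : 'I_m.+1 * 'I_m.+1) (X Y : {vspace V}) : bool :=
  (\dim (att_proj E W X :&: att_proj E W Y) + ij.1 == m) &&
  (\dim (X :&: Y) + ij.1 + ij.2 == m).

Definition att_cdim (F : finFieldType) (V : vectType F) (E W : {vspace V})
    (m : nat) : nat :=
  cdim (att_points E m) (@att_rel F V E W m).

Lemma dim_att_proj (F : finFieldType) (V : vectType F) (n l m : nat)
    (E W X : {vspace V}) :
  att_frame n l E W -> X \in att_points E m -> \dim (att_proj E W X) = m.
Proof.
move=> [_ _ EW0 EWV]; rewrite inE => /andP[/eqP dX /eqP XE0].
rewrite limg_dim_eq ?dX //; apply/eqP; rewrite -subv0; apply/subvP=> u.
rewrite memv_cap memv_ker => /andP[uX /eqP pu0].
rewrite -XE0 memv_cap uX /= -[u](@daddv_pi_add _ _ W E) ?pu0 ?add0r ?memv_pi //.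
  by rewrite capvC.
by rewrite addvC EWV memvf.
Qed.

Lemma att_rel_partition (F : finFieldType) (V : vectType F) (n l m : nat)
    (E W X Y : {vspace V}) :
  att_frame n l E W -> X \in att_points E m -> Y \in att_points E m ->
  exists! ij, @att_rel F V E W m ij X Y.
Proof.
move=> fr XO YO.
have a_le : \dim (att_proj E W X :&: att_proj E W Y) <= m.
  by rewrite -(dim_att_proj fr XO) dimvS ?capvSl.
have b_le : \dim (X :&: Y) <= \dim (att_proj E W X :&: att_proj E W Y).
  have XYO : (X :&: Y)%VS \in att_points E (\dim (X :&: Y)).
    rewrite inE eqxx /= -subv0; move: XO; rewrite inE => /andP[_ /eqP <-].
    by rewrite capvS ?capvSl.
  rewrite -(dim_att_proj fr XYO) dimvS // subv_cap.
  by rewrite !limgS ?capvSl ?capvSr.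
rewrite /att_rel; move: a_le b_le.
move: (\dim (_ :&: Y)) (\dim (att_proj E W X :&: _)) => b a a_le b_le.
have i_lt : m - a < m.+1 by rewrite ltnS leq_subr.
have j_lt : a - b < m.+1 by rewrite ltnS (leq_trans (leq_subr _ _)).
exists (Ordinal i_lt, Ordinal j_lt); split=> [|[i j]] /=.
  by rewrite subnKC // eqxx /= addnAC subnKC // subnKC ?eqxx.
move=> /andP[/eqP ai /eqP bij]; congr (_, _); apply/val_inj => /=.
  by apply: (@addnI a); rewrite ai subnKC.
have -> : a = b + j by apply: (@addIn i); rewrite ai addnAC bij.
by rewrite addKn.
Qed.

Lemma att_points_resolving (F : finFieldType) (V : vectType F) (n l m : nat)
    (E W : {vspace V}) :
  att_frame n l E W ->
  class_resolving (att_points E m) (@att_rel F V E W m) (att_points E m).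
Proof.
move=> fr; apply/class_resolvingP; split=> // X Y XO YO /(_ X XO).
have dim_label Z : Z \in att_points E m -> exists ij,
    rel_label (@att_rel F V E W m) X Z = Some ij
    /\ \dim (X :&: Z) + ij.1 + ij.2 = m.
  move=> ZO; rewrite /rel_label; case: pickP => [ij /andP[_ /eqP]|no].
    by exists ij.
  by have [ij [/idP]] := att_rel_partition fr XO ZO; rewrite no.
have [ij [-> dX]] := dim_label X XO; have [kl [-> dY]] := dim_label Y YO.
case=> eq_l; move: dY; rewrite -eq_l -{}[in RHS]dX => /addIn/addIn.
move: XO YO; rewrite capvv !inE => /andP[/eqP dX _] /andP[/eqP dY _] dXY.
have /eqP XYX : (X :&: Y == X)%VS by rewrite eqEdim capvSl dXY leqnn.
have /eqP XYY : (X :&: Y == Y)%VS by rewrite eqEdim capvSr dXY dX dY leqnn.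
by rewrite -XYX [LHS]XYY.
Qed.

(* Main.v *)
Require Import Defs.
From HB Require Import structures.
From mathcomp Require Import all_boot all_order all_algebra finfield.
From mathcomp Require Import all_classical all_reals all_analysis.
From mathcomp Require Import lra ring.

(* Lower bound.  Fix an m-subspace U of W, the row space of a row-free matrix B.
   The q^(ml) points X with pi(X) = U are the graphs of the linear maps U -> E,
   and on them the label of (s, X) depends only on dim(X :&: s), which is nonzero
   with probability at most (q^d - 1)/(q - 1) q^-l, where d = dim(U :&: pi(s)).
   Hence, to first order, s carries at most (q^d - 1)/(q - 1) q^-l l ln q nats
   about X; as the labels determine X, these contributions add up to at least
   ml ln q.  Averaging over U, the mean of q^d - 1 is at most about
   (q^m - 1)^2 q^-n, which gives the constant.  Entropies are replaced by cross
   entropies against explicit weights: 1 - q^-l for dim(X :&: s) = 0 and q^-l/m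
   for each other dimension.

   Upper bound.  In Q^V the characteristic vectors of the points have inner
   products q^dim(X :&: Y), and these are functions of the labels; so the points
   forming a basis of the span of all these vectors are class-resolving. *)

Set Implicit Arguments.
Unset Strict Implicit.
Unset Printing Implicit Defensive.

Import Order.TTheory GRing.Theory Num.Theory.
Import numFieldNormedType.Exports.

Local Open Scope ring_scope.

(** * Counting matrices and coordinates on subspaces *)

(** Since [c != 0], there is a linear section [P] with [c *m P e = e]. The translates of the
    solution set by the q^k matrices [P e] are pairwise disjoint, because [c *m _] tells them
    apart. *)
Lemma card_mulmx_row_le (F : finFieldType) (m k : nat) (c : 'rV[F]_m)
    (d : 'rV[F]_k) :
  c != 0 -> (#|[set M : 'M[F]_(m, k) | c *m M == d]| * #|F| ^ k <= #|F| ^ (m * k))%N.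
Proof.
move=> /rV0Pn[i ci].
pose P (e : 'rV[F]_k) : 'M[F]_(m, k) := delta_mx i 0 *m ((c 0 i)^-1 *: e).
have cP e : c *m P e = e.
  rewrite mulmxA -colE -scalemxAr [col i c]mx11_scalar mul_scalar_mx mxE scalerA.
  by rewrite mulVf ?scale1r.
pose A := [set M : 'M[F]_(m, k) | c *m M == d].
pose h (x : 'M[F]_(m, k) * 'rV[F]_k) := x.1 + P x.2.
have hinj : {in finset.setX A [set: 'rV[F]_k] &, injective h}.
  move=> [M e] [M' e']; rewrite !inE !andbT /= => /eqP cM /eqP cM' /[dup] eqh.
  rewrite /h /= => /(congr1 (mulmx c)); rewrite !mulmxDr !cP cM cM'.
  by move=> /addrI ee; move: eqh; rewrite /h ee /= => /addIr ->.
rewrite -(card_mx F m k); have := max_card (mem (h @: finset.setX A [set: 'rV[F]_k])).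
by rewrite (card_in_imset hinj) cardsX cardsT (card_mx F 1 k) mul1n.
Qed.

(** Union bound: a matrix that is not row-free is killed by some nonzero [c], and each [c] kills at
    most a fraction q^-n of all matrices. So the row-free ones have proportion at least 1 - q^(m-n),
    stated without subtraction or division. *)
Lemma card_row_free_ge (F : finFieldType) (m n : nat) :
  (#|F| ^ (m * n) * #|F| ^ n <=
   #|[set B : 'M[F]_(m, n) | row_free B]| * #|F| ^ n + #|F| ^ m * #|F| ^ (m * n))%N.
Proof.
pose G := [set B : 'M[F]_(m, n) | row_free B].
have sub : ~: G \subset \bigcup_(c : 'rV[F]_m | c != 0) [set B : 'M[F]_(m, n) | c *m B == 0].
  apply/fintype.subsetP => B; rewrite !inE -kermx_eq0 => /rowV0Pn[c /sub_kermxP cB c0].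
  by apply/bigcupP; exists c => //; rewrite inE cB.
have le : (#|~: G| * #|F| ^ n <= #|F| ^ m * #|F| ^ (m * n))%N.
  apply: leq_trans (_ : (\sum_(c : 'rV[F]_m | c != 0%R)
    #|[set B : 'M[F]_(m, n) | c *m B == 0%R]| * #|F| ^ n <= _)%N).
    rewrite -big_distrl leq_mul2r; apply/orP; right.
    apply: leq_trans (subset_leq_card sub) _.
    elim/big_ind2: _ => [|A1 a1 A2 a2 H1 H2|//]; first by rewrite cards0.
    by apply: leq_trans (leq_card_setU _ _) _; apply: leq_add.
  apply: leq_trans (_ : \sum_(c : 'rV[F]_m | c != 0%R) #|F| ^ (m * n) <= _)%N.
    by apply: leq_sum => c c0; apply: card_mulmx_row_le.
  rewrite sum_nat_const leq_mul2r; apply/orP; right.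
  by rewrite -[m in (_ ^ m)%N]mul1n -card_mx max_card.
by rewrite -{1}(card_mx F m n) -(cardsC G) mulnDl leq_add2l.
Qed.

(** Supplies coordinates on [W], [E], [V] and single points, so that counting vectors and graphs
    becomes counting matrices. *)
Lemma vspace_param (F : fieldType) (V : vectType F) (U : {vspace V}) (k : nat) :
  \dim U = k ->
  exists a : 'Hom('rV[F]_k, V), lker a = 0%VS /\ limg a = U.
Proof.
move=> <-.
pose X := vbasis U.
pose f (x : 'rV[F]_(\dim U)) := \sum_i x 0 i *: X`_i.
have flin : linear f.
  move=> t x y; rewrite /f scaler_sumr -big_split; apply: eq_bigr => i _.
  by rewrite !mxE scalerDl scalerA.
pose fL := GRing.isLinear.Build _ _ _ _ f flin.
pose f' : {linear _ -> _} := HB.pack f fL.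
have fX : free X := basis_free (vbasisP U).
exists (linfun f'); split.
  apply/eqP/lker0P => x y; rewrite !lfunE /= /f => exy.
  apply/rowP => j; have /freeP/(_ (fun i => x 0 i - y 0 i)) := fX.
  have -> : \sum_i (x 0 i - y 0 i) *: X`_i = 0.
    by under eq_bigr do rewrite scalerBl; rewrite sumrB exy subrr.
  by move=> /(_ erefl j)/eqP; rewrite subr_eq0 => /eqP.
apply/vspaceP => v; apply/memv_imgP/idP => [[x _ ->]|vU].
  rewrite lfunE /= /f; apply: memv_suml => i _; apply: memvZ.
  by apply: vbasis_mem; apply: mem_nth; rewrite size_tuple.
exists (\row_i coord X i v); first exact: memvf.
rewrite lfunE /= /f {1}(coord_vbasis vU); apply: eq_bigr => i _.
by rewrite mxE.
Qed.

Lemma sum_nat_of_bool (T : finType) (A : {set T}) (P : pred T) :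
  (\sum_(x in A) P x)%N = #|[set x in A | P x]|.
Proof.
by rewrite -sum1dep_card big_mkcondr /=; apply: eq_bigr => x _; case: (P x).
Qed.

(** * Points with a prescribed projection, as graphs *)

Section GraphFamily.

Variables (F : finFieldType) (V : vectType F) (E W : {vspace V}) (m n l : nat).
Variables (a : 'Hom('rV[F]_n, V)) (b : 'Hom('rV[F]_l, V)).
Hypotheses (EW0 : (E :&: W = 0)%VS) (EWV : (E + W = fullv)%VS).
Hypotheses (ker_a : lker a = 0%VS) (im_a : limg a = W).
Hypotheses (ker_b : lker b = 0%VS) (im_b : limg b = E).

(* Graphs of linear maps from the row space of B to E, in coordinates: when B is
   row-free, M |-> graph_space B M enumerates a fibre of [att_proj E W]. *)
Definition graph_map (B : 'M[F]_(m, n)) (M : 'M[F]_(m, l)) : 'Hom('rV[F]_m, V) :=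
  ((a \o linfun (mulmxr B)) + (b \o linfun (mulmxr M)))%VF.

Definition graph_space B M : {vspace V} := limg (graph_map B M).

Lemma graph_mapE B M c : graph_map B M c = a (c *m B) + b (c *m M).
Proof. by rewrite add_lfunE !comp_lfunE !lfunE. Qed.

Let a_injective : injective a. Proof. by apply/lker0P; rewrite ker_a. Qed.
Let b_injective : injective b. Proof. by apply/lker0P; rewrite ker_b. Qed.
Let a_in x : a x \in W. Proof. by rewrite -im_a memv_img ?memvf. Qed.
Let b_in y : b y \in E. Proof. by rewrite -im_b memv_img ?memvf. Qed.

Let WE0 : (W :&: E = 0)%VS. Proof. by rewrite capvC. Qed.

Let proj_E v : v \in E -> daddv_pi W E v = 0.
Proof.
move=> vE; have : v \in (W + E)%VS by rewrite addvC EWV memvf.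
move=> /(daddv_pi_add WE0); rewrite [X in _ + X]daddv_pi_id //.
by move/(canRL (addrK _)); rewrite subrr.
Qed.

Lemma daddv_pi_sum x y : daddv_pi W E (a x + b y) = a x.
Proof. by rewrite linearD /= daddv_pi_id ?a_in ?WE0 // proj_E ?b_in ?addr0. Qed.

Lemma lker_graph_map B M : row_free B -> lker (graph_map B M) = 0%VS.
Proof.
move=> Bfree; apply/eqP/lker0P => c d /(congr1 (daddv_pi W E)).
by rewrite !graph_mapE !daddv_pi_sum => /a_injective/(row_free_inj Bfree).
Qed.

Lemma dim_graph_space B M : row_free B -> \dim (graph_space B M) = m.
Proof.
move=> Bfree; rewrite /graph_space limg_dim_eq ?lker_graph_map ?capv0 //.
by rewrite dimvf /dim /= mul1n.
Qed.

Lemma graph_space_point B M : row_free B -> graph_space B M \in att_points E m.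
Proof.
move=> Bfree; rewrite inE dim_graph_space // eqxx /= -subv0; apply/subvP => v.
rewrite memv_cap => /andP[/memv_imgP[c _ ->]] /proj_E.
rewrite graph_mapE daddv_pi_sum -(linear0 a) => /a_injective.
rewrite -[0 in RHS](mul0mx _ B) => /(row_free_inj Bfree) ->.
by rewrite !mul0mx !linear0 addr0 mem0v.
Qed.

Lemma att_proj_graph_space B M :
  att_proj E W (graph_space B M) = limg (a \o linfun (mulmxr B))%VF.
Proof.
rewrite /att_proj /graph_space -limg_comp; congr (limg _).
by apply/lfunP => c; rewrite !comp_lfunE graph_mapE daddv_pi_sum lfunE.
Qed.

Lemma graph_space_inj B : row_free B -> injective (graph_space B).
Proof.
move=> Bfree M M' eqMM'; apply/row_matrixP => i; rewrite !rowE.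
have : graph_map B M (delta_mx 0 i) \in graph_space B M'.
  by rewrite -eqMM' memv_img ?memvf.
case/memv_imgP => c _; rewrite !graph_mapE => eqc.
have := congr1 (daddv_pi W E) eqc; rewrite !daddv_pi_sum => /a_injective/(row_free_inj Bfree) ec.
by move: eqc; rewrite -ec => /addrI/b_injective.
Qed.

(** All graphs over the same [B] have the same projection, so the label can only vary through the
    dimension of the intersection with [s]. *)
Lemma rel_label_graph_space B M M' s :
  \dim (s :&: graph_space B M) = \dim (s :&: graph_space B M') ->
  rel_label (@att_rel F V E W m) s (graph_space B M) =
  rel_label (@att_rel F V E W m) s (graph_space B M').
Proof.
by move=> e; apply: eq_pick => ij; rewrite /att_rel !att_proj_graph_space e.
Qed.

(** The projection of [s] to [W] along [E], read in the coordinates [a]. *)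
Definition shadow (s : {vspace V}) : pred 'rV[F]_n :=
  fun x => [exists y, a x + b y \in s].

(* For row-free B and a point s of the scheme, this is q^d - 1, where d is the
   dimension of the intersection of the projections of s and [graph_space B M]. *)
Definition hits (s : {vspace V}) (B : 'M[F]_(m, n)) : nat :=
  #|[set c : 'rV[F]_m | (c != 0) && shadow s (c *m B)]|.

(** The shadow is the linear image of the m-dimensional [s], so its nonzero vectors come from
    nonzero parameters [c]. *)
Lemma card_shadow s : s \in att_points E m ->
  (#|[set x : 'rV[F]_n | (x != 0%R) && shadow s x]| <= #|F| ^ m - 1)%N.
Proof.
rewrite inE => /andP[/eqP/vspace_param[g [ker_g im_g]] sE0].
have -> : (#|F| ^ m - 1 = #|[set~ (0%R : 'rV[F]_m)]|)%N.
  by rewrite cardsC1 (card_mx F 1 m) mul1n subn1.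
apply: leq_trans (leq_imset_card (fun c => (a^-1)%VF (daddv_pi W E (g c))) _).
apply: subset_leq_card; apply/fintype.subsetP => x; rewrite inE => /andP[x0].
case/existsP => y; rewrite -im_g => /memv_imgP[c _ ec].
apply/imsetP; exists c; last by rewrite -ec daddv_pi_sum lker0_lfunK ?ker_a.
rewrite !inE; apply: contraNneq x0 => c0; move: ec; rewrite c0 linear0.
by move/(congr1 (daddv_pi W E)); rewrite daddv_pi_sum linear0 -(linear0 a) => /a_injective ->.
Qed.

(** Double counting of the pairs (M, c) with c nonzero and [graph_map B M c] in [s]. If the graph of
    M meets [s], all q - 1 nonzero multiples of one c qualify. Conversely c must be a hit, and then
    [c *m M] is prescribed: two vectors of [s] over the same vector of [W] differ by an element of
    [s :&: E = 0]. *)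
Lemma card_meet_le s B : s \in att_points E m ->
  ((#|F| - 1) * #|[set M : 'M[F]_(m, l) | (s :&: graph_space B M)%VS != 0%VS]| *
     #|F| ^ l <= hits s B * #|F| ^ (m * l))%N.
Proof.
rewrite inE => /andP[_ /eqP sE0].
pose H := [set c : 'rV[F]_m | (c != 0) && shadow s (c *m B)].
pose Q := [set M : 'M[F]_(m, l) | (s :&: graph_space B M)%VS != 0%VS].
apply: leq_trans (_ : ((\sum_(M in Q) \sum_(c in H) (graph_map B M c \in s)) * #|F| ^ l <= _)%N).
  rewrite leq_mul2r mulnC -sum_nat_const; apply/orP; right; apply: leq_sum => M.
  rewrite inE -vpick0; set v := vpick _ => v0.
  have /memv_capP[vs /memv_imgP[c _ vc]] : v \in (s :&: graph_space B M)%VS.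
    exact: memv_pick.
  have c0 : c != 0 by apply: contraNneq v0 => c0; rewrite vc c0 linear0.
  have scale_inj : injective (fun k : F => k *: c).
    by move=> k k' /eqP; rewrite -subr_eq0 -scalerBl scaler_eq0 (negbTE c0) orbF subr_eq0 => /eqP.
  have -> : (#|F| - 1 = #|[set k *: c | k in [set~ (0%R : F)]]|)%N.
    by rewrite card_imset // cardsC1 subn1.
  rewrite sum_nat_of_bool; apply: subset_leq_card; apply/fintype.subsetP => d.
  case/imsetP => k; rewrite !inE => k0 ->; rewrite scaler_eq0 negb_or k0 c0 /=.
  have ks : graph_map B M (k *: c) \in s by rewrite linearZ; apply: memvZ; move: vs; rewrite vc.
  by rewrite ks andbT; apply/existsP; exists (k *: c *m M); rewrite -graph_mapE.
rewrite exchange_big /= big_distrl /= /hits -/H -sum_nat_const.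
apply: leq_sum => c; rewrite inE => /andP[c0 /existsP[y ys]].
apply: leq_trans (card_mulmx_row_le y c0); rewrite leq_mul2r; apply/orP; right.
rewrite sum_nat_of_bool; apply: subset_leq_card; apply/fintype.subsetP => M.
rewrite !inE graph_mapE => /andP[_ Ms]; apply/eqP/b_injective/eqP; rewrite -subr_eq0.
rewrite -memv0 -sE0 memv_cap -linearB b_in andbT.
by rewrite linearB -(addrKA (a (c *m B))) memvB // addrC.
Qed.

(** Double counting of the triples (B, c, x) with c nonzero, x a nonzero vector of the shadow and
    [c *m B = x]. Row-freeness makes [c *m B] nonzero; there are at most q^m - 1 choices for each of
    c and x, and a fraction at most q^-n of all matrices solves each equation. *)
Lemma sum_hits_le s : s \in att_points E m ->
  ((\sum_(B : 'M[F]_(m, n) | row_free B) hits s B) * #|F| ^ n <=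
    (#|F| ^ m - 1) ^ 2 * #|F| ^ (m * n))%N.
Proof.
move=> sO; pose Z := [set x : 'rV[F]_n | (x != 0) && shadow s x].
have card_nz : #|[set~ (0 : 'rV[F]_m)]| = (#|F| ^ m - 1)%N.
  by rewrite cardsC1 (card_mx F 1 m) mul1n subn1.
have hitsE B : row_free B ->
    (hits s B <= \sum_(c in [set~ (0%R : 'rV[F]_m)]) \sum_(x in Z) (c *m B == x))%N.
  move=> Bfree; rewrite /hits -sum1_card.
  rewrite (eq_bigl (fun c => (c \in [set~ 0]) && shadow s (c *m B))); last first.
    by move=> c; rewrite !inE.
  rewrite big_mkcondr /=; apply: leq_sum => c; rewrite !inE => c0.
  case: ifP => // cB; rewrite (bigD1 (c *m B)) /=; first by rewrite eqxx leq_addr.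
  rewrite inE cB andbT; apply: contra c0 => /eqP.
  by rewrite -[0 in RHS](mul0mx _ B) => /(row_free_inj Bfree) ->.
apply: leq_trans (_ : ((\sum_(c in [set~ (0%R : 'rV[F]_m)]) \sum_(x in Z)
   #|[set B : 'M[F]_(m, n) | c *m B == x]|) * #|F| ^ n <= _)%N).
  rewrite leq_mul2r; apply/orP; right.
  apply: leq_trans; first by apply: leq_sum => B; apply: hitsE.
  rewrite exchange_big /=; apply: leq_sum => c _; rewrite exchange_big /=.
  apply: leq_sum => x _; rewrite -sum1dep_card big_mkcond [leqRHS]big_mkcond /=.
  by apply: leq_sum => B _; case: row_free; case: eqP.
rewrite big_distrl /= -mulnn -mulnA -{1}card_nz -sum_nat_const; apply: leq_sum => c.
rewrite !inE => c0; rewrite big_distrl /=.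
apply: leq_trans (_ : \sum_(x in Z) #|F| ^ (m * n) <= _)%N.
  by apply: leq_sum => x _; apply: card_mulmx_row_le.
by rewrite sum_nat_const leq_mul2r card_shadow ?orbT.
Qed.

Lemma resolving_graph_inj (S : {set {vspace V}}) B M M' :
  class_resolving (att_points E m) (@att_rel F V E W m) S -> row_free B ->
  {in S, forall s, \dim (s :&: graph_space B M) = \dim (s :&: graph_space B M')} ->
  M = M'.
Proof.
case/class_resolvingP => _ res Bfree eqd; apply: (graph_space_inj Bfree).
apply: res => [||s sS]; [exact: graph_space_point..|].
exact: rel_label_graph_space (eqd s sS).
Qed.

Lemma dim_meet_le s B M : row_free B -> (\dim (s :&: graph_space B M) <= m)%N.
Proof. by move=> Bfree; rewrite -(dim_graph_space M Bfree) dimvS ?capvSr. Qed.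

End GraphFamily.

(** * The upper bound by characteristic vectors *)

Lemma rel_label_dim (F : finFieldType) (V : vectType F) (n l m : nat)
    (E W s X Y : {vspace V}) :
  att_frame n l E W -> s \in att_points E m -> X \in att_points E m ->
  Y \in att_points E m ->
  rel_label (@att_rel F V E W m) s X = rel_label (@att_rel F V E W m) s Y ->
  \dim (s :&: X) = \dim (s :&: Y).
Proof.
move=> fr sO XO YO; rewrite /rel_label.
case: pickP => [[i j] /andP[_ /eqP dX]|no]; last first.
  by have [ij [/idP]] := att_rel_partition fr sO XO; rewrite no.
case: pickP => // -[i' j'] /andP[_ /eqP dY] [ei ej]; rewrite ei ej in dX.
by move: dX; rewrite -{}[in RHS]dY => /addIn/addIn.
Qed.

Lemma card_preim_vspace (F : finFieldType) (V : vectType F) (N : nat)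
    (e : 'Hom('rV[F]_N, V)) (U : {vspace V}) :
  lker e = 0%VS -> limg e = fullv ->
  #|[set x : 'rV[F]_N | e x \in U]| = (#|F| ^ \dim U)%N.
Proof.
move=> ker_e im_e; move dimU: (\dim U) => k; have [g [ker_g im_g]] := vspace_param dimU.
have inv_e v : e ((e^-1)%VF v) = v by rewrite limg_lfunVK // im_e memvf.
rewrite -[RHS](_ : #|{: 'rV[F]_k}| = _); last by rewrite (card_mx F 1) mul1n.
have inj : injective (fun x => (e^-1)%VF (g x)).
  move=> x y /(congr1 e); rewrite !inv_e; apply/lker0P; by rewrite ker_g.
rewrite -(card_imset _ inj); apply: eq_card => x; rewrite inE.
apply/idP/imsetP => [|[y _ ->]].
  rewrite -im_g => /memv_imgP[y _ exy]; exists y => //.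
  by rewrite -exy lker0_lfunK ?ker_e.
by rewrite inv_e -im_g memv_img ?memvf.
Qed.

Lemma att_cdim_le (F : finFieldType) (V : vectType F) (n l m : nat)
    (E W : {vspace V}) :
  att_frame n l E W -> (att_cdim E W m <= #|F| ^ (n + l))%N.
Proof.
move=> fr; pose O := att_points E m; have [dimV _ _ _] := fr.
have [e [ker_e im_e]] := vspace_param dimV.
pose fV : finType := 'rV[F]_(n + l).
have card_fV : #|fV| = (#|F| ^ (n + l))%N by rewrite (card_mx F 1) mul1n.
pose chi (X : {vspace V}) : 'rV[rat]_#|fV| :=
  \row_j (e (@enum_val fV fV j) \in X)%:R.
(* The inner product counts the vectors common to [X] and [Y]. *)
have dot X Y : chi X *m (chi Y)^T = (#|F| ^ \dim (X :&: Y))%:R%:M.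
  apply/rowP => i; rewrite ord1 !mxE mulr1n -(card_preim_vspace _ ker_e im_e).
  rewrite -sum1dep_card natr_sum [RHS]big_mkcond /=.
  rewrite [RHS](reindex (@enum_val fV fV)) /=; last exact/onW_bij/enum_val_bij.
  apply: eq_bigr => j _.
  by rewrite !mxE memv_cap; do 2![case: (_ \in _)]; rewrite ?mulr1 ?mulr0.
pose A : 'M[rat]_(#|O|, #|fV|) := \matrix_i chi (enum_val i).
pose f := maxrankfun A.
pose S := [set enum_val (f i) | i : 'I_(\rank A)].
have [_ cdim_min] := cdimP (att_points_resolving m fr).
apply: leq_trans (cdim_min S _) _; last first.
  rewrite -card_fV (leq_trans (leq_imset_card _ _)) // card_ord.
  exact: rank_leq_col.
apply/class_resolvingP; split=> [|X Y XO YO eql].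
  by apply/fintype.subsetP => _ /imsetP[i _ ->]; apply: enum_valP.
(* Equal labels give orthogonality to the rows chosen by [maxrankfun]; these span all rows of [A],
   so it extends to every point. *)
have orth Z : Z \in O -> chi Z *m (chi X - chi Y)^T = 0.
  move=> ZO; have AZ : chi Z = row (enum_rank_in ZO Z) A.
    by apply/rowP => j; rewrite !mxE enum_rankK_in.
  have : (chi Z <= rowsub f A)%MS by rewrite AZ eq_maxrowsub row_sub.
  case/submxP => D ->; rewrite -mulmxA [X in D *m X](_ : _ = 0) ?mulmx0 //.
  apply/row_matrixP => i; rewrite row_mul row0.
  have -> : row i (rowsub f A) = chi (enum_val (f i)).
    by apply/rowP => j; rewrite !mxE.
  have fS : enum_val (f i) \in S by apply: imset_f.
  rewrite linearB mulmxBr !dot (rel_label_dim fr _ XO YO (eql _ fS)) ?subrr //.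
  exact: enum_valP.
(* [chi X - chi Y] is orthogonal to itself, and over [rat] a sum of squares vanishes only
   termwise. *)
have XY0 : chi X = chi Y.
  apply/eqP; rewrite -subr_eq0; apply/eqP; apply/rowP => j; rewrite [RHS]mxE.
  have /matrixP/(_ 0 0) : (chi X - chi Y) *m (chi X - chi Y)^T = 0.
    by rewrite mulmxBl !orth // subrr.
  rewrite mxE [RHS]mxE => /psumr_eq0P/(_ j isT) h.
  have /eqP := h (fun j _ => ltac:(by rewrite [X in _ * X]mxE -expr2 sqr_ge0)).
  by rewrite [X in _ * X]mxE mulf_eq0 orbb => /eqP.
apply/vspaceP => v; have /rowP/(_ (enum_rank ((e^-1)%VF v : fV))) := XY0.
rewrite !mxE enum_rankK limg_lfunVK ?im_e ?memvf // => /eqP; rewrite eqr_nat.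
by case: (v \in X); case: (v \in Y).
Qed.

(** * Logarithms and Gibbs' inequality *)

Lemma ln_le_sub1 (R : realType) (x : R) : 0 < x -> ln x <= x - 1.
Proof.
move=> x0; have := @le_ln1Dx R (x - 1); rewrite [1 + _]addrC subrK; apply.
by rewrite ltrBrDr addNr.
Qed.

Lemma ln_prod (R : realType) (I : finType) (F : I -> R) :
  (forall i, 0 < F i) -> ln (\prod_i F i) = \sum_i ln (F i).
Proof.
move=> F0; suff [] : 0 < \prod_i F i /\ ln (\prod_i F i) = \sum_i ln (F i) by [].
elim/big_rec2: _ => [|i x y _ [y0 <-]]; first by rewrite ln1.
by rewrite mulr_gt0 // lnM // posrE.
Qed.

(* Gibbs' inequality for the uniform distribution on [T], seen through the
   injective labelling [f], against the product of the subprobabilities [w i]. *)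
Lemma card_ln_le_cross_entropy (R : realType) (T I J : finType)
    (f : T -> {ffun I -> J}) (w : I -> J -> R) :
  injective f -> (forall i j, 0 <= w i j) -> (forall i, \sum_j w i j <= 1) ->
  (forall t i, 0 < w i (f t i)) ->
  #|T|%:R * ln #|T|%:R <= \sum_t \sum_i - ln (w i (f t i)).
Proof.
move=> finj w0 w1 wf; pose P t := \prod_i w i (f t i).
have P0 t : 0 < P t by apply: prodr_gt0.
(* By injectivity the [P t] are distinct terms in the expansion of the product over i of the sums of
   [w i]. *)
have P1 : \sum_t P t <= 1.
  apply: (@le_trans _ _ (\sum_(g : {ffun I -> J}) \prod_i w i (g i))).
    rewrite -(big_imset (fun g : {ffun I -> J} => \prod_i w i (g i)) (in2W finj)) /=.
    rewrite [leRHS](bigID (mem (f @: T))) /=.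
    by rewrite lerDl sumr_ge0 // => g _; apply: prodr_ge0.
  by rewrite -bigA_distr_bigA /=; apply: prodr_ile1 => i _; rewrite w1 sumr_ge0.
have [T0|T0] := posnP #|T|; first by rewrite T0 mul0r sumr_ge0 // => t _; have := card0_eq T0 t; rewrite !inE.
have N0 : 0 < #|T|%:R :> R by rewrite ltr0n.
(* Sum over t of ln x <= x - 1 at x = [#|T| * P t]; the right-hand side totals at most 0. *)
have : \sum_(t : T) (ln #|T|%:R + \sum_i ln (w i (f t i))) <= \sum_(t : T) (#|T|%:R * P t - 1).
  apply: ler_sum => t _; rewrite -ln_prod // -lnM ?posrE ?P0 //.
  exact/ln_le_sub1/(mulr_gt0 N0 (P0 t)).
rewrite !big_split /= sumr_const sumrN sumr_const -mulr_sumr -mulr_natl.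
have -> : \sum_t \sum_i - ln (w i (f t i)) = - \sum_t \sum_i ln (w i (f t i)).
  by rewrite -sumrN; apply: eq_bigr => t _; rewrite sumrN.
rewrite [#|[eta T]|](_ : _ = #|T|) // => h; rewrite -subr_ge0.
have := ler_wpM2l (ltW N0) P1; move: h; rewrite /=; lra.
Qed.

(** * Entropy bounds for a resolving set *)

(** Gibbs' inequality for the q^(ml) graphs over one [B], labelled by the dimensions of their
    intersections with the points of [S]. In the last factor, ln m is the price of spreading q^-l
    evenly over the m nonzero dimensions, and 2(q - 1) accounts for the cost of dimension 0. *)
Lemma hits_sum_ge (R : realType) (F : finFieldType) (V : vectType F)
    (E W : {vspace V}) (m n l : nat)
    (a : 'Hom('rV[F]_n, V)) (b : 'Hom('rV[F]_l, V))
    (S : {set {vspace V}}) (B : 'M[F]_(m, n)) :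
  (E :&: W = 0)%VS -> (E + W = fullv)%VS ->
  lker a = 0%VS -> limg a = W -> lker b = 0%VS -> limg b = E ->
  (0 < m)%N -> (0 < l)%N ->
  class_resolving (att_points E m) (@att_rel F V E W m) S -> row_free B ->
  m%:R * l%:R * ln (#|F|%:R : R) * (#|F|%:R - 1) * #|F|%:R ^+ l <=
    (\sum_(s in S) hits a b s B)%:R *
    (l%:R * ln #|F|%:R + (ln m%:R + 2 * (#|F|%:R - 1))).
Proof.
move=> EW0 EWV ker_a im_a ker_b im_b m0 l0 Sres Bfree.
have SO : S \subset att_points E m by case/class_resolvingP: Sres.
set q : R := #|F|%:R; set L := ln q; set h := fun s => hits a b s B.
have q2 : 2 <= q by rewrite ler_nat (finNzRing_gt1 F).
have q0 : 0 < q by lra.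
have m0R : 0 < m%:R :> R by rewrite ltr0n.
have ql0 : 0 < q ^+ l by apply: exprn_gt0.
pose d : R := (q ^+ l)^-1.
have d0 : 0 < d by rewrite invr_gt0.
have d2 : d <= 2^-1.
  rewrite lef_pV2 ?posrE //; apply: (le_trans q2).
  by rewrite -[leLHS]expr1; apply: ler_weXn2l => //; lra.
(* From ln x <= x - 1 at x = 1/(1 - d), which leaves d/(1 - d); this is at most 2d as d <= 1/2. *)
have ln_d1 : - ln (1 - d) <= 2 * d.
  have d1 : 0 < 1 - d by lra.
  rewrite -lnV ?posrE //; apply: le_trans (ln_le_sub1 _) _; first by rewrite invr_gt0.
  rewrite -(ler_pM2r d1) mulrBl mulVf ?gt_eqF //; nra.
have ln_dm : - ln (d / m%:R) = l%:R * L + ln m%:R.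
  rewrite -lnV ?posrE ?divr_gt0 // invf_div invrK lnM ?posrE // lnXn //.
  by rewrite addrC mulr_natl.
pose X M := graph_space a b B M.
(* A point without hits meets no graph over [B], and outside [S] the label is constantly [ord0];
   such coordinates get the point mass at 0 and cost nothing. Every active point has at least one
   hit. *)
pose act s := (s \in S) && (0 < h s)%N.
pose f (M : 'M[F]_(m, l)) : {ffun {vspace V} -> 'I_m.+1} :=
  [ffun s => if s \in S then inord (\dim (s :&: X M)) else ord0].
pose w s (j : 'I_m.+1) : R := if act s then (if j == ord0 then 1 - d else d / m%:R)
                  else (j == ord0)%:R.
pose Q s := [set M : 'M[F]_(m, l) | (s :&: X M)%VS != 0%VS].
have Qle s : s \in S -> ((#|F| - 1) * #|Q s| * #|F| ^ l <= h s * #|F| ^ (m * l))%N.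
  move=> sS; apply: (card_meet_le a ker_b im_b); exact: (fintype.subsetP SO).
have dimX s M : (\dim (s :&: X M) < m.+1)%N by rewrite ltnS (dim_meet_le EW0 EWV ker_a im_a im_b).
have f0 M s : s \in S -> (f M s == ord0) = (M \notin Q s).
  move=> sS; rewrite ffunE sS inE negbK -val_eqE /= inordK //.
  by rewrite dimv_eq0.
have fnact M s : ~~ act s -> f M s = ord0.
  rewrite /act; case: (boolP (s \in S)) => [sS /= | sS _]; last by rewrite ffunE (negbTE sS).
  rewrite lt0n negbK => /eqP hs0; apply/eqP; rewrite f0 //.
  have F1 := finNzRing_gt1 F; have := Qle _ sS; rewrite hs0 mul0n leqn0 !muln_eq0.
  rewrite subn_eq0 leqNgt F1 expn_eq0 (gtn_eqF (ltnW F1)) orbF cards_eq0 => /eqP ->.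
  by rewrite inE.
have finj : injective f.
  move=> M M' /ffunP eqf; apply: (resolving_graph_inj EW0 EWV ker_a im_a ker_b im_b Sres Bfree).
  by move=> s sS; have := congr1 val (eqf s); rewrite !ffunE sS /= !inordK.
have w0 s j : 0 <= w s j.
  by rewrite /w; case: (act s); case: eqP => // _; rewrite ?divr_ge0 //; lra.
have w1 s : \sum_j w s j <= 1.
  rewrite big_ord_recl /w; case: (act s) => /=.
    rewrite sumr_const card_ord -[d / _ *+ _]mulr_natr mulfVK ?gt_eqF //; lra.
  by rewrite big1 ?addr0.
have wf M s : 0 < w s (f M s).
  rewrite /w; case: (boolP (act s)) => [_|/fnact -> //].
  by case: eqP => _; rewrite ?divr_gt0 //; lra.
have := card_ln_le_cross_entropy finj w0 w1 wf.
have cardM : #|{: 'M[F]_(m, l)}| = (#|F| ^ (m * l))%N by apply: card_mx.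
rewrite cardM natrX -/q.
have N0 : 0 < q ^+ (m * l) by apply: exprn_gt0.
set N := q ^+ (m * l) in N0 *.
set C := ln m%:R + 2 * (q - 1).
have lnm0 : 0 <= ln m%:R :> R by rewrite ln_ge0 // ler1n.
have L0 : 0 <= L by rewrite ln_ge0 //; lra.
rewrite lnXn // -/L exchange_big /= => ent.
suff bnd s : \sum_M - ln (w s (f M s)) <=
   (if s \in S then (h s)%:R else 0) * (N * d / (q - 1) * (l%:R * L + C)).
  have := le_trans ent (ler_sum _ (fun s _ => bnd s)).
  rewrite -mulr_suml -big_mkcond /= -natr_sum -[L *+ _]mulr_natl natrM.
  set H : R := (\sum_(i in S) h i)%:R.
  have -> : H * (N * d / (q - 1) * (l%:R * L + C)) =
     N * ((H * (l%:R * L + C)) * (d / (q-1))) by ring.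
  rewrite ler_pM2l // -ler_pdivrMr ?divr_gt0 ?subr_gt0 //; last by lra.
  by rewrite invf_div /d invrK mulrA.
have K0 : 0 <= N * d / (q - 1) * (l%:R * L + C).
  have C0 : 0 <= C by rewrite /C; lra.
  have q1 : 0 <= q - 1 by lra.
  apply: mulr_ge0; last by rewrite addr_ge0 ?mulr_ge0.
  by apply: divr_ge0 => //; apply: mulr_ge0; apply: ltW.
have [acts|nact] := boolP (act s); last first.
  rewrite big1 => [|M _]; last by rewrite /w (negbTE nact) fnact // eqxx ln1 oppr0.
  by rewrite mulr_ge0 //; case: ifP.
have [sS hs] := andP acts; rewrite sS.
(* A graph that misses [s] costs at most 2d, one that meets it costs [- ln (d / m)]; the 2d is
   granted to all graphs. *)
apply: (@le_trans _ _ (\sum_(M : 'M[F]_(m, l)) (2 * d + (M \in Q s)%:R * (l%:R * L + ln m%:R)))).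
  apply: ler_sum => M _; rewrite /w acts f0 //.
  have lL0 : 0 <= l%:R * L + ln m%:R by rewrite addr_ge0 ?mulr_ge0.
  by case: (M \in Q s) => /=; rewrite ?ln_dm ?mul1r ?mul0r; lra.
rewrite big_split /= sumr_const -mulr_suml -natr_sum.
have -> : (\sum_(M : 'M[F]_(m, l)) (M \in Q s))%N = #|Q s|.
  by rewrite -sum1_card [RHS]big_mkcond; apply: eq_bigr => M _; case: (_ \in _).
rewrite cardM -[2 * d *+ _]mulr_natl natrX -/q -/N.
have Qs : #|Q s|%:R <= (h s)%:R * N * d / (q - 1).
  rewrite ler_pdivlMr; last by lra.
  rewrite /d ler_pdivlMr //.
  have := Qle s sS; rewrite -(ler_nat R) !natrM !natrX -/q -/N natrB ?(ltnW (finNzRing_gt1 F)) //.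
  by rewrite -/q; lra.
have h1 : 1 <= (h s)%:R :> R by rewrite ler1n.
have lL0 : 0 <= l%:R * L + ln m%:R by rewrite addr_ge0 ?mulr_ge0.
have := ler_wpM2r lL0 Qs.
(* As [h s >= 1], the total cost 2dN of dimension 0 can be charged to the hits; this produces the
   term 2(q - 1) of [C]. *)
have Nd : N * d * 2 <= (h s)%:R * (N * d * 2) by rewrite ler_peMl //; nra.
have -> : (h s)%:R * (N * d / (q - 1) * (l%:R * L + C)) =
  (h s)%:R * N * d / (q - 1) * (l%:R * L + ln m%:R) + (h s)%:R * (N * d * 2).
  by rewrite /C; field; rewrite gt_eqF // subr_gt0; lra.
lra.
Qed.

(** Sum the hits over all pairs of a point s in [S] and a row-free [B]: [hits_sum_ge] bounds the sum
    from below for each [B], [sum_hits_le] from above for each s. The factor q^n - q^m comes from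
    the number of row-free matrices. *)
Lemma resolving_card_ge (R : realType) (F : finFieldType) (V : vectType F)
    (E W : {vspace V}) (m n l : nat) (S : {set {vspace V}}) :
  att_frame n l E W -> (0 < m)%N -> (0 < l)%N ->
  class_resolving (att_points E m) (@att_rel F V E W m) S ->
  m%:R * l%:R * ln (#|F|%:R : R) * (#|F|%:R - 1) * #|F|%:R ^+ l *
      (#|F|%:R ^+ n - #|F|%:R ^+ m) <=
    #|S|%:R * (#|F|%:R ^+ m - 1) ^+ 2 *
    (l%:R * ln #|F|%:R + (ln m%:R + 2 * (#|F|%:R - 1))).
Proof.
move=> [dimV dimE EW0 EWV] m0 l0 Sres.
have SO : S \subset att_points E m by case/class_resolvingP: Sres.
have dimW : \dim W = n.
  apply: (@addnI l); rewrite -{1}dimE -dimv_disjoint_sum // EWV dimV addnC //.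
have [a [ker_a im_a]] := vspace_param dimW.
have [b [ker_b im_b]] := vspace_param dimE.
have F1 := finNzRing_gt1 F.
set q : R := #|F|%:R; set L := ln q; set C := ln m%:R + _.
have q2 : 2 <= q by rewrite ler_nat.
have lnm0 : 0 <= ln m%:R :> R by rewrite ln_ge0 // ler1n.
have C0 : 0 <= C by rewrite /C -/q; lra.
have L0 : 0 <= L by rewrite ln_ge0 //; lra.
have lLC0 : 0 <= l%:R * L + C by rewrite addr_ge0 ?mulr_ge0.
set P := m%:R * l%:R * L * (q - 1) * q ^+ l.
have P0 : 0 <= P.
  have q1 : 0 <= q - 1 by lra.
  by rewrite !mulr_ge0 // exprn_ge0 //; lra.
set N := q ^+ (m * n).
have N0 : 0 < N by rewrite exprn_gt0 //; lra.
pose G := [set B : 'M[F]_(m, n) | row_free B]%SET.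
have G_ge : N * (q ^+ n - q ^+ m) <= #|G|%:R * q ^+ n.
  have := card_row_free_ge F m n.
  by rewrite -(ler_nat R) natrD !natrM !natrX -/q -/N; lra.
pose h s (B : 'M[F]_(m, n)) := hits a b s B.
have Ph : #|G|%:R * P <= (\sum_(s in S) \sum_(B | row_free B) h s B)%:R * (l%:R * L + C).
  rewrite exchange_big /= natr_sum mulr_suml.
  have -> : #|G|%:R * P = \sum_(B : 'M[F]_(m, n) | row_free B) P.
    by rewrite sumr_const -[RHS]mulr_natl /G cardsE.
  apply: ler_sum => B Bfree.
  exact: (hits_sum_ge R EW0 EWV ker_a im_a ker_b im_b m0 l0 Sres Bfree).
have hS : (\sum_(s in S) \sum_(B : 'M[F]_(m, n) | row_free B) h s B)%:R * q ^+ n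
    <= #|S|%:R * (q ^+ m - 1) ^+ 2 * N.
  have : ((\sum_(s in S) \sum_(B : 'M[F]_(m, n) | row_free B) h s B) * #|F| ^ n <=
     #|S| * ((#|F| ^ m - 1) ^ 2 * #|F| ^ (m * n)))%N.
    rewrite big_distrl -sum_nat_const; apply: leq_sum => s sS.
    apply: (sum_hits_le EW0 EWV ker_a im_a im_b); exact: (fintype.subsetP SO).
  rewrite -(ler_nat R) !natrM !natrX natrB ?expn_gt0 ?(ltnW F1) // natrX.
  by rewrite -/q -/N mulrA.
have qn0 : 0 < q ^+ n by rewrite exprn_gt0 //; lra.
rewrite -(ler_pM2l N0).
have := ler_wpM2r P0 G_ge.
have := ler_wpM2r (ltW qn0) Ph.
have := ler_wpM2r lLC0 hS.
set H := (\sum_(s in S) _)%:R; lra.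
Qed.

(** * Asymptotics in n and l *)

Local Open Scope classical_set_scope.
Local Open Scope ring_scope.

Theorem corollary5p2 (R : realType) (q m : nat)
    (q_prime_power : exists p e : nat,
       [/\ prime p, (0 < e)%N & q = (p ^ e)%N])
    (m_ge1 : (1 <= m)%N) :
  (exists o : nat * nat -> R,
     o @ filter_prod \oo \oo --> (0 : R) /\
     forall (n l : nat) (F : finFieldType) (V : vectType F)
            (E W : {vspace V}),
       #|F| = q -> (m <= n)%N -> att_frame n l E W ->
       (m%:R * (q%:R - 1) / (q%:R ^+ m - 1) ^+ 2 + o (n, l)) * q%:R ^+ (n + l)
         <= (att_cdim E W m)%:R :> R)
  /\
  (exists a b : R,
     [/\ 0 < a, 0 < b &
      exists N : nat, forall (n l : nat) (F : finFieldType) (V : vectType F)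
            (E W : {vspace V}),
       (N <= n)%N -> (N <= l)%N -> #|F| = q -> att_frame n l E W ->
       a * q%:R ^+ (n + l) <= (att_cdim E W m)%:R :> R /\
       (att_cdim E W m)%:R <= b * q%:R ^+ (n + l) :> R]).
Proof.
have [p [e [p_prime e0 qE]]] := q_prime_power.
have q_gt1 : (1 < q)%N by rewrite qE -(exp1n e) ltn_exp2r // prime_gt1.
set Q : R := q%:R.
have Q2 : 2 <= Q by rewrite ler_nat.
have Qm1 : 0 < Q ^+ m - 1.
  by rewrite subr_gt0 exprn_egt1 ?gtn_eqF //; lra.
set K := m%:R * (Q - 1) / (Q ^+ m - 1) ^+ 2.
have m0 : 0 < m%:R :> R by rewrite ltr0n.
have K0 : 0 < K by rewrite divr_gt0 ?exprn_gt0 // mulr_gt0 //; lra.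
set L := ln Q.
have L0 : 0 < L by apply: ln_gt0; lra.
pose C := ln m%:R + 2 * (Q - 1).
have C_ge : L <= C.
  have := @ln_le_sub1 R Q; rewrite -/L /C.
  have : 0 <= ln m%:R :> R by rewrite ln_ge0 // ler1n.
  by move=> ? /(_ ltac:(lra)); lra.
pose D := C / L.
have DL : D * L = C by rewrite divfK // gt_eqF.
have D1 : 1 <= D by rewrite ler_pdivlMr // mul1r.
(* The finite bound has main factor K (1 - q^(m-n)) lL/(lL + C). Replacing lL/(lL + C) by 1 and
   subtracting D/(l+1) instead gives a smaller quantity that is linear in the two error terms. *)
pose o (nl : nat * nat) : R := - (K * (Q ^+ m * Q^-1 ^+ nl.1 + D * harmonic nl.2)).
have o0 : o @ filter_prod \oo \oo --> (0 : R).
  have -> : 0 = - (K * (Q ^+ m * 0 + D * 0)) :> R by ring.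
  apply: cvgN; apply: cvgM; first exact: cvg_cst.
  apply: cvgD; apply: cvgM; try exact: cvg_cst.
    apply: (cvg_comp fst (fun n : nat => Q^-1 ^+ n)); first exact: cvg_fst.
    apply: cvg_expr; rewrite ger0_norm ?invr_ge0; [|lra].
    by rewrite invf_lt1; lra.
  by apply: (cvg_comp snd harmonic); [exact: cvg_snd|exact: cvg_harmonic].
have lower (n l : nat) (F : finFieldType) (V : vectType F) (E W : {vspace V}) :
    #|F| = q -> att_frame n l E W -> 
    (K + o (n, l)) * Q ^+ (n + l) <= (att_cdim E W m)%:R.
  move=> Fq fr; have qnl0 : 0 < Q ^+ (n + l) by rewrite exprn_gt0 //; lra.
  have qn0 : 0 < Q ^+ n by rewrite exprn_gt0 //; lra.
  have qm0 : 0 < Q ^+ m by rewrite exprn_gt0 //; lra.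
  have ql0 : 0 < Q ^+ l by rewrite exprn_gt0 //; lra.
  pose A : R := 1 - Q ^+ m / Q ^+ n.
  pose H : R := l.+1%:R^-1.
  have oE : K + o (n, l) = K * (A - D * H).
    by rewrite /o /A /H /= exprVn; ring.
  have H0 : 0 < H by rewrite invr_gt0 ltr0n.
  have DH0 : 0 <= D * H by apply: mulr_ge0; lra.
  have r0 : 0 < Q ^+ m / Q ^+ n by rewrite divr_gt0.
  have A1 : A <= 1 by rewrite /A; lra.
  rewrite oE.
  (* A nonpositive left-hand side is trivial. This covers n <= m, where [A <= 0], and l = 0, where
     [H = 1] and [D >= 1 >= A]. *)
  have [ADH|ADH] := lerP (A - D * H) 0.
    apply: le_trans (ler0n _ _); rewrite pmulr_lle0 //.
    by rewrite pmulr_rle0.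
  have [[S Sres SE] _] := cdimP (att_points_resolving m fr).
  rewrite /att_cdim -SE.
  have l0 : (0 < l)%N.
    rewrite lt0n; apply: contraTneq ADH => l00; rewrite -leNgt /H l00 invr1; lra.
  have := resolving_card_ge R fr m_ge1 l0 Sres.
  rewrite Fq -/Q -/L -/C.
  have lR : 1 <= l%:R :> R by rewrite ler1n.
  have HE : H * (l%:R + 1) = 1 by rewrite /H natr1 mulVf // pnatr_eq0.
  have den : 0 < l%:R * L + C by rewrite ltr_wpDl ?mulr_ge0 // ?ltW //; lra.
  have -> : Q ^+ n - Q ^+ m = A * Q ^+ n.
    by rewrite /A mulrBl divfK ?gt_eqF // mul1r.
  have -> : m%:R * l%:R * L * (Q - 1) * Q ^+ l * (A * Q ^+ n) =
     K * A * Q ^+ (n + l) * (l%:R * L) * (Q ^+ m - 1) ^+ 2.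
    by rewrite /K exprD; field; rewrite gt_eqF.
  rewrite [leRHS]mulrAC ler_pM2r ?exprn_gt0 // => main.
  rewrite -(ler_pM2r den); apply: le_trans main.
  have A0 : 0 < A by lra.
  suff : (A - D * H) * (l%:R * L + C) <= A * (l%:R * L).
    move=> /(ler_wpM2l (ltW (mulr_gt0 K0 qnl0))); lra.
  (* [D * L = C] and [H = 1/(l+1)] give [C = D * H * (l%:R * L + L)]; then use [A <= 1] and
     [L <= C]. *)
  have : A * C <= D * H * (l%:R * L + C).
    have : C = D * H * (l%:R * L + L).
      have -> : D * H * (l%:R * L + L) = D * L * (H * (l%:R + 1)) by ring.
      by rewrite HE mulr1.
    have : D * H * (l%:R * L + L) <= D * H * (l%:R * L + C).
      by apply: ler_wpM2l => //; lra.
    have : A * C <= C by rewrite ler_piMl //; lra.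
    lra.
  lra.
split; first by exists o; split=> // n l F V E W Fq _; apply: lower.
(* Beyond N the error is at least -K/2, which leaves the lower constant K/2; the upper constant 1
   comes from [att_cdim_le]. *)
have [N oN] : exists N : nat, forall n l, (N <= n)%N -> (N <= l)%N -> - (K / 2) <= o (n, l).
  have /cvgrPdist_lt/(_ (K / 2)) := o0.
  case=> [|[P1 P2] /= [[N1 _ H1] [N2 _ H2]] P12]; first by rewrite divr_gt0.
  exists (maxn N1 N2) => n l; rewrite !geq_max => /andP[n1 _] /andP[_ l2].
  have := P12 (n, l); rewrite /= sub0r normrN => /(_ (conj (H1 _ n1) (H2 _ l2))).
  by rewrite ltr_norml => /andP[/ltW].
exists (K / 2), 1; split; [by rewrite divr_gt0|by []|].
exists N => n l F V E W Nn Nl Fq fr; split.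
  apply: le_trans (lower _ _ _ _ _ _ Fq fr); apply: ler_wpM2r.
    by rewrite exprn_ge0 //; lra.
  by have := oN _ _ Nn Nl; lra.
by rewrite mul1r /Q -Fq -natrX ler_nat; apply: att_cdim_le fr.
Qed.
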